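(* Let $\mathbf{p}(t)$ be a planar parametric curve with bounded, piecewise continuous components on the interval $[0,1]$, and let $(q_k)_{k=1}^M$ be the Bernstein basis for the implicit polynomials of degree $m$. For each number of samples $L\ge 2$, let $\mathbf{D}_{\mathrm{L},L}$ be the $L\times M$ matrix with entries $d_{j,k}=q_k(\mathbf{p}(t_j))$, $j=1,\dots,L$, $k=1,\dots,M$, at the uniform nodes $t_j=(j-1)/(L-1)$. Let $\mathbf{M}_1$ be the $M\times M$ matrix with entries $(\mathbf{M}_1)_{k,l}=\int_0^1 q_k(\mathbf{p}(t))\,q_l(\mathbf{p}(t))\,dt$. Then the $(k,l)$ element of ${\mathbf{D}_{\mathrm{L},L}}^T\mathbf{D}_{\mathrm{L},L}$ converges to a constant multiple of the $(k,l)$ element of $\mathbf{M}_1$ as the number of samples $L$ is increased.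
   Context: The curve is given either in affine coordinates, as a map from $[0,1]$ to $\mathbb{R}^2$, or in homogeneous coordinates in the projective plane $\mathbb{P}^2$, as a triple of functions on $[0,1]$. The implicit basis has $M=\binom{m+2}{2}$ elements and is the Bernstein basis, consisting of the polynomials $\binom{m}{k_1,k_2,k_3}u^{k_1}v^{k_2}w^{k_3}$ with $k_1+k_2+k_3=m$, ordered lexicographically and indexed by $k=1,\dots,M$. Here $u,v,w$ are barycentric coordinates with respect to a triangle containing the curve (affine case) or homogeneous coordinates (projective case).
   Formalization: The elements of D^T D grow like L (a constant curve gives L times the element of M_1), so the literal claim fails; what is proved is that 1/L times the (k,l) element of D^T D converges to the (k,l) element of M_1. *)

(* Defs.v *)
From HB Require Import structures.
From mathcomp Require Import all_boot all_order all_algebra.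
From mathcomp Require Import all_classical all_reals all_analysis.

Set Implicit Arguments.
Unset Strict Implicit.
Unset Printing Implicit Defensive.

Import Order.TTheory GRing.Theory Num.Theory.
Import numFieldNormedType.Exports.

Local Open Scope classical_set_scope.
Local Open Scope ring_scope.

(* The exponents (k1, k2, k3) with k1 + k2 + k3 = m, in increasing
   lexicographic order. *)
Definition bernstein_exponents (m : nat) : seq (nat * nat * nat) :=
  [seq (i, j, (m - i - j)%N) | i <- iota 0 m.+1, j <- iota 0 (m - i).+1].

Lemma size_bernstein_exponents m :
  size (bernstein_exponents m) = 'C(m + 2, 2).
Proof.
rewrite size_allpairs_dep sumnE big_map addn2 -bin2_sum.
under eq_bigr do rewrite size_iota.
rewrite -[m.+1 in LHS]subn0 -/(index_iota 0 m.+1) big_nat_rev /= add0n.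
rewrite [RHS]big_ltn // add0n big_add1 /= !big_nat.
by apply: eq_bigr => i; rewrite ltnS subSS => /subKn ->.
Qed.

Lemma mem_bernstein_exponents m i j k :
  ((i, j, k) \in bernstein_exponents m) = (i + j + k == m)%N.
Proof.
apply/allpairsPdep/eqP => [[i' [j' []]]|<-].
  rewrite !mem_iota !add0n !ltnS => /= i'm j'm [-> -> ->].
  by rewrite -subnDA subnKC // -(subnKC i'm) leq_add2l.
exists i, j; rewrite !mem_iota !add0n !ltnS /=.
by rewrite -addnA leq_addr !addKn leq_addr.
Qed.

Lemma uniq_bernstein_exponents m : uniq (bernstein_exponents m).
Proof.
apply: allpairs_uniq_dep => [|i _|]; rewrite ?iota_uniq //.
by move=> [i j] [i' j'] _ _ /= [-> ->].
Qed.

(* 'I_'C(m + 2, 2) is numbered from 0, so bernstein m k is q_(k+1). *)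
Definition bernstein (R : realType) (m : nat) (k : 'I_('C(m + 2, 2)))
    (x : 'rV[R]_3) : R :=
  let: (k1, k2, k3) := nth (0, 0, 0)%N (bernstein_exponents m) k in
  (m`!%:R / (k1`! * k2`! * k3`!)%:R) *
    (x 0 0 ^+ k1 * x 0 1 ^+ k2 * x 0 (inord 2) ^+ k3).

(* A triangle is given by the matrix whose three rows are its vertices. *)
Definition homogenize (R : realType) (n : nat) (A : 'M[R]_(n, 2)) :
  'M[R]_(n, 3) := row_mx (const_mx 1 : 'cV_n) A.

Definition nondegenerate (R : realType) (T : 'M[R]_(3, 2)) : bool :=
  homogenize T \in unitmx.

Definition triangle (R : realType) (T : 'M[R]_(3, 2)) : set 'rV[R]_2 :=
  [set x | exists w : 'rV[R]_3,
    [/\ forall i, 0 <= w 0 i, \sum_i w 0 i = 1 & x = w *m T]].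

Definition barycentric (R : realType) (T : 'M[R]_(3, 2)) (x : 'rV[R]_2) :
  'rV[R]_3 := homogenize x *m invmx (homogenize T).

Lemma barycentricP (R : realType) (T : 'M[R]_(3, 2)) (x : 'rV[R]_2)
    (w : 'rV[R]_3) : nondegenerate T ->
  w = barycentric T x <-> \sum_i w 0 i = 1 /\ w *m T = x.
Proof.
move=> uT.
have -> : w = barycentric T x <-> w *m homogenize T = homogenize x.
  by rewrite /barycentric; split=> [->|<-]; rewrite ?mulmxKV ?mulmxK.
have -> : w *m homogenize T = row_mx (w *m const_mx 1 : 'M[R]_1) (w *m T).
  exact: (mul_mx_row w (const_mx 1 : 'cV_3) T).
rewrite /homogenize; split=> [/(@eq_row_mx _ _ 1 2)[w1 ->]|[w1 ->]].
  split=> //; move/matrixP: w1 => /(_ 0 0); rewrite !mxE => <-.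
  by apply: eq_bigr => i _; rewrite mxE mulr1.
suff -> : w *m const_mx 1 = const_mx 1 :> 'M[R]_1 by [].
apply/matrixP => i j; rewrite !ord1 !mxE -[RHS]w1.
by apply: eq_bigr => k _; rewrite mxE mulr1.
Qed.

(* The functions are total, but only their values on [0, 1] are meaningful. *)
Inductive planar_curve (R : realType) : Type :=
| AffineCurve of 'M[R]_(3, 2) & (R -> 'rV[R]_2)
| ProjectiveCurve of (R -> 'rV[R]_3).

Definition wf_curve (R : realType) (p : planar_curve R) : Prop :=
  match p with
  | AffineCurve T f =>
      nondegenerate T /\ (forall t : R, t \in `[0, 1] -> triangle T (f t))
  | ProjectiveCurve h => forall t : R, t \in `[0, 1] -> h t != 0
  end.

(* No one-sided limits are required at the breakpoints, and the values there
   are arbitrary. *)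
Definition piecewise_continuous (R : realType) (a b : R) (f : R -> R) : Prop :=
  exists2 s : seq R, itv_partition a b s &
    forall i, (i < size s)%N ->
      {in `](nth b (a :: s) i), (nth b s i)[, continuous f}.

Definition bounded_piecewise_continuous (R : realType) (a b : R)
    (f : R -> R) : Prop :=
  [bounded f t | t in `[a, b]] /\ piecewise_continuous a b f.

Definition regular_components (R : realType) (p : planar_curve R) : Prop :=
  match p with
  | AffineCurve _ f =>
      forall i, bounded_piecewise_continuous 0 1 (fun t => f t 0 i)
  | ProjectiveCurve h =>
      forall i, bounded_piecewise_continuous 0 1 (fun t => h t 0 i)
  end.

Definition curve_uvw (R : realType) (p : planar_curve R) (t : R) : 'rV[R]_3 :=
  match p with
  | AffineCurve T f => barycentric T (f t)
  | ProjectiveCurve h => h t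
  end.

(* Rows are numbered from 0, so the node of row j is j / (L - 1). *)
Definition uniform_node (R : realType) (L : nat) (j : 'I_L) : R :=
  j%:R / L.-1%:R.

Definition sample_matrix (R : realType) (m : nat) (p : planar_curve R)
    (L : nat) : 'M[R]_(L, 'C(m + 2, 2)) :=
  \matrix_(j, k) bernstein k (curve_uvw p (uniform_node R j)).

(* The entries of D^T *m D, for D := sample_matrix m p L, are unnormalized
   Riemann sums growing like L times those of gram_matrix; the convergent
   quantity is L^-1 * (D^T *m D) k l. *)
Definition gram_matrix (R : realType) (m : nat) (p : planar_curve R) :
    'M[R]_('C(m + 2, 2)) :=
  \matrix_(k, l) \int[lebesgue_measure]_(t in `[0, 1])
    (bernstein k (curve_uvw p t) * bernstein l (curve_uvw p t)).

(* Main.v *)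
Require Import Defs.
From HB Require Import structures.
From mathcomp Require Import all_boot all_order all_algebra.
From mathcomp Require Import all_classical all_reals all_analysis.
From mathcomp Require Import measurable_realfun lra.

Set Implicit Arguments.
Unset Strict Implicit.
Unset Printing Implicit Defensive.

Import Order.TTheory GRing.Theory Num.Theory.
Import numFieldNormedType.Exports.

Local Open Scope classical_set_scope.
Local Open Scope ring_scope.

(* Every entry of the Gram matrix is the integral of a function f that is
   bounded on [0, 1] and continuous off a finite set, and L^-1 (D^T D) k l is
   the mean of f over the nodes j / (L - 1), j < L. This mean is exactly the
   integral of the step function equal to f (j / (L - 1)) on the j-th interval
   [j / L, (j + 1) / L[ of length 1 / L. Since that node is at distance at most
   1 / (L - 1) from each point of the interval, the step functions converge to f
   at its points of continuity, and dominated convergence applies. *)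

(** * Step functions on [L] equal subintervals *)

Definition riemann_step (R : realType) (f : R -> R) (L : nat) (t : R) : R :=
  \sum_(j < L) f (uniform_node R j) * \1_(`[j%:R / L%:R, j.+1%:R / L%:R[) t.

Lemma ltn_truncn_mul (R : realType) (L : nat) (t : R) :
  (0 < L)%N -> t \in `[0, 1[ -> (Num.truncn (L%:R * t) < L)%N.
Proof.
move=> L0; rewrite in_itv/= => /andP[t0 t1].
by rewrite truncn_lt_nat ?mulr_ge0// -[ltRHS]mulr1 ltr_pM2l ?ltr0n.
Qed.

Lemma uniform_node_itv (R : realType) (L k : nat) :
  (k < L)%N -> k%:R / L.-1%:R \in (`[0, 1] : interval R).
Proof.
case: L => // L; rewrite ltnS => kL; rewrite in_itv/= divr_ge0//=.
(* For a single sample the denominator is zero; since [0^-1 = 0], the node is 0. *)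
case: L kL => [|L] kL; first by rewrite invr0 mulr0.
by rewrite ler_pdivrMr ?ltr0n// mul1r ler_nat.
Qed.

(** On [[0, 1[] the half-open intervals are the level sets of [Num.truncn (L%:R * t)], so exactly
    one indicator is nonzero at [t]; the point 1 belongs to none of them. *)
Lemma riemann_stepE (R : realType) (f : R -> R) (L : nat) (t : R) :
    (0 < L)%N -> t \in `[0, 1[ ->
  riemann_step f L t = f ((Num.truncn (L%:R * t))%:R / L.-1%:R).
Proof.
move=> L0 t01; have kL := ltn_truncn_mul L0 t01.
move: t01; rewrite in_itv/= => /andP[t0 t1].
have L0R : 0 < L%:R :> R by rewrite ltr0n.
have Lt0 : 0 <= L%:R * t by rewrite mulr_ge0// ltW.
have memE j : (t \in `[j%:R / L%:R, j.+1%:R / L%:R[) =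
    (Num.truncn (L%:R * t) == j).
  by rewrite truncn_eq// in_itv/= ler_pdivrMr// ltr_pdivlMr// mulrC.
rewrite /riemann_step (bigD1 (Ordinal kL))//= big1 ?addr0 => [|j /negPf jk].
  by rewrite indicE mem_set ?mulr1//=; rewrite memE.
rewrite indicE memNset ?mulr0//=; rewrite memE => /eqP kj.
by move: jk; rewrite -val_eqE/= kj eqxx.
Qed.

Lemma integrable_riemann_summand (R : realType) (f : R -> R) (L : nat)
    (j : 'I_L) :
  lebesgue_measure.-integrable `[0, 1]
    (fun t : R => (f (uniform_node R j))%:E *
       (\1_(`[j%:R / L%:R, j.+1%:R / L%:R[) t)%:E)%E.
Proof.
apply: integrableZl => //; apply: (integrableS measurableT) => //.
exact: integrable_indic_itv.
Qed.

Lemma riemann_step_EFin (R : realType) (f : R -> R) (L : nat) :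
  EFin \o riemann_step f L = (fun t : R => \sum_(j < L)
     (f (uniform_node R j))%:E *
       (\1_(`[j%:R / L%:R, j.+1%:R / L%:R[) t)%:E)%E.
Proof.
by apply/funext => t; rewrite /= /riemann_step -sumEFin.
Qed.

Lemma measurable_riemann_step (R : realType) (f : R -> R) (L : nat) :
  measurable_fun (`[0, 1] : set R) (EFin \o riemann_step f L).
Proof.
rewrite riemann_step_EFin; apply: emeasurable_sum => j _.
exact: (measurable_int _ (integrable_riemann_summand f j)).
Qed.

Lemma integral_riemann_step (R : realType) (f : R -> R) (L : nat) :
  (\int[lebesgue_measure]_(t in `[0%R, 1%R]) (riemann_step f L t)%:E =
   (L%:R^-1 * \sum_(j < L) f (uniform_node R j))%:E)%E.
Proof.
under eq_integral do rewrite -[(riemann_step _ _ _)%:E]/((EFin \o _) _).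
rewrite riemann_step_EFin integral_sum// => [|j]; last first.
  exact: integrable_riemann_summand.
rewrite mulr_sumr -sumEFin; apply: eq_bigr => j _.
(* The index [j] itself forces [L] to be positive; for [L = 0] both sides are empty sums. *)
have L0 : (0 < L)%N := leq_ltn_trans (leq0n j) (ltn_ord j).
have L0R : 0 < L%:R :> R by rewrite ltr0n.
rewrite integralZl//; last first.
  apply: (integrableS measurableT) => //; exact: integrable_indic_itv.
rewrite integral_indic// setIidl; last first.
  move=> t; rewrite /= !in_itv/= => /andP[jt tj].
  rewrite (le_trans _ jt) ?divr_ge0//= (le_trans (ltW tj))//.
  by rewrite ler_pdivrMr// mul1r ler_nat.
transitivity (mule (f (uniform_node R j))%:E
    (lebesgue_measure (`[j%:R / L%:R, j.+1%:R / L%:R[ : set R))) => //.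
rewrite lebesgue_measure_itv/= lte_fin ltr_pM2r ?invr_gt0// ltr_nat leqnn.
by rewrite -EFinD -EFinM -mulrBl -natrB// subSnn mul1r mulrC.
Qed.

(** For [k] the truncation of [L t], the bounds [k <= L t < k + 1] and [0 <= t <= 1] put
    [(L - 1) t - k] in [[-1, 1]], so the node is within [1 / (L - 1)] of [t]. *)
Lemma cvg_truncn_node (R : realType) (t : R) : t \in `[0, 1] ->
  (Num.truncn (L%:R * t))%:R / L.-1%:R @[L --> \oo] --> t.
Proof.
rewrite in_itv/= => /andP[t0 t1].
(* Writing [L = n + 2] makes [L - 1 = n + 1] positive and the error bound the harmonic sequence. *)
rewrite -(cvg_shiftn 2)/=.
apply/cvgrPdist_le => e e0.
have /cvgrPdist_le/(_ e e0) := @cvg_harmonic R; apply: filterS => n.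
rewrite /harmonic /= sub0r normrN addn2 /= => /(le_trans _); apply.
have n0 : 0 < n.+1%:R :> R by rewrite ltr0n.
rewrite [leRHS]gtr0_norm ?invr_gt0// -[leRHS]div1r ler_pdivlMr//.
rewrite -[X in _ * X](gtr0_norm n0) -normrM mulrBl divfK ?gt_eqF//.
have := @truncn_itv R (n.+2%:R * t); rewrite mulr_ge0// => /(_ isT).
rewrite -2!natr1; set k := _%:R; rewrite ler_norml => /andP[? ?].
by apply/andP; split; rewrite -?natr1; lra.
Qed.

(** * Convergence of uniform Riemann sums *)

(** A finite exceptional set replaces the ordered partition, so that sums and products only require
    a union of such sets rather than a common refinement. *)
Definition bounded_cofinitely_continuous (R : realType) (f : R -> R) : Prop :=
  (exists M : R, forall t : R, t \in `[0, 1] -> `|f t| <= M) /\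
  exists2 N : set R, finite_set N &
    forall t : R, t \in `]0, 1[ -> ~ N t -> {for t, continuous f}.

Lemma riemann_sum_cvg (R : realType) (f : R -> R) :
    bounded_cofinitely_continuous f ->
  L%:R^-1 * (\sum_(j < L) f (uniform_node R j)) @[L --> \oo] -->
  \int[lebesgue_measure]_(t in `[0, 1]) f t.
Proof.
move=> [[M fM] [N0 finN0 fc]].
(* The endpoints join the exceptional set: continuity is known only inside the interval, and the
   step functions vanish at 1. *)
pose N := N0 `|` [set 0; 1].
have cN : countable N.
  by apply: finite_set_countable; rewrite finite_setU; split.
have mN : measurable N by apply: countable_measurable.
have muN : lebesgue_measure N = 0%E := countable_lebesgue_measure0 cN.
have inD (t : R) : t \in `[0, 1] -> ~ N t -> (t \in `]0, 1[) /\ ~ N0 t.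
  rewrite !in_itv/= => /andP[t0 t1] Nt; split; last first.
    by apply: contra_not Nt; left.
  by rewrite !lt_neqAle t0 t1 !andbT; apply/andP; split; apply/negP => /eqP tE;
    apply: Nt; right; [left|right].
have stepf (t : R) : t \in `[0, 1] -> ~ N t ->
    riemann_step f ^~ t @ \oo --> f t.
  move=> t01 Nt; have [t01' N0t] := inD _ t01 Nt.
  have /= := cvg_comp _ _ (cvg_truncn_node t01) (fc _ t01' N0t).
  apply: cvg_trans; apply: near_eq_cvg; near=> L.
  rewrite riemann_stepE//; first by near: L; exists 1%N.
  by move: t01'; rewrite !in_itv/= => /andP[/ltW -> ->].
(* Off [N], [f] is a pointwise limit of measurable step functions; within the countable set [N],
   every preimage is countable. *)
have mf : measurable_fun (`[0, 1] : set R) (EFin \o f).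
  rewrite -(setUIDK (`[0, 1] : set R) N) setUC.
  apply/measurable_funU; [exact: measurableD|exact: measurableI|split].
    apply: (emeasurable_fun_cvg (fun L => EFin \o riemann_step f L)).
      by move=> L; apply: measurable_funS (measurable_riemann_step f L).
    by move=> t [t01 Nt]; apply: cvg_EFin; [exact: nearW|exact: stepf].
  move=> _ Y mY; apply: countable_measurable => //.
  by apply: sub_countable cN; apply: subset_card_le => t [[]].
have aeN : {ae lebesgue_measure, forall t, ~ N t}.
  exists N; split => //; by move=> t /= /contrapT.
have filterS_ae :=
  @filterS _ _ (ae_filter_ringOfSetsType (@lebesgue_measure R)).
have stepM : {ae lebesgue_measure, forall (t : R) (L : nat),
    t \in `[0, 1] -> (`|(EFin \o riemann_step f L) t| <= (cst M t)%:E)%E}.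
  apply: (filterS_ae _ _ _ aeN) => t Nt L t01; have [/= + _] := inD _ t01 Nt.
  rewrite in_itv/= => /andP[t0 t1]; rewrite lee_fin.
  (* For [L = 0] the step function is zero, and [M] is nonnegative because it bounds [|f t|]. *)
  have [->|L0] := posnP L; first
    by rewrite /riemann_step big_ord0 normr0 (le_trans _ (fM t t01)).
  rewrite riemann_stepE//; last by rewrite in_itv/= (ltW t0).
  apply: fM; apply: uniform_node_itv (ltn_truncn_mul L0 _).
  by rewrite in_itv/= (ltW t0).
have intM : lebesgue_measure.-integrable (`[0, 1] : set R) (EFin \o cst M).
  apply: measurable_bounded_integrable => //.
    suff : (lebesgue_measure (`[0%R, 1%R] : set R) < +oo)%E by [].
    by rewrite lebesgue_measure_itv/= lte_fin ltr01 -EFinD ltry.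
  exact: bounded_cst.
have step_ae : {ae lebesgue_measure, forall t : R, t \in `[0, 1] ->
    (EFin \o riemann_step f L) t @[L --> \oo] --> (EFin \o f) t}.
  apply: (filterS_ae _ _ _ aeN) => t Nt t01.
  by apply: cvg_EFin; [exact: nearW|exact: stepf].
have := @dominated_convergence _ _ _ (@lebesgue_measure R) _
  (measurable_itv `[0%R, 1%R]) (fun L => EFin \o riemann_step f L)
  (EFin \o f) (EFin \o cst M) (measurable_riemann_step f) mf.
move=> /(_ step_ae intM stepM)[intf _].
(* Integrability makes the limit integral finite, so convergence in the extended reals passes
   through [fine] to the real-valued integral. *)
have /(_ (measurable_itv `[0%R, 1%R])) intf_fin :=
  fun mI => integrable_fin_num mI intf.
rewrite -(fineK intf_fin) => /fine_cvg; apply: cvg_trans; apply: near_eq_cvg.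
by apply: nearW => L /=; rewrite integral_riemann_step.
Unshelve. all: end_near.
Qed.

(** * Closure properties, and the case of piecewise continuous functions *)

Section BoundedCofinitelyContinuous.
Context {R : realType}.
Implicit Types f g : R -> R.

Lemma bounded_cofinitely_continuous_cst (c : R) :
  bounded_cofinitely_continuous (fun=> c).
Proof.
split; first by exists `|c|.
by exists set0 => // t _ _; exact: cst_continuous.
Qed.

Lemma bounded_cofinitely_continuousD f g :
  bounded_cofinitely_continuous f -> bounded_cofinitely_continuous g ->
  bounded_cofinitely_continuous (fun t => f t + g t).
Proof.
move=> [[A fA] [M finM fc]] [[B gB] [N finN gc]]; split.
  by exists (A + B) => t t01; rewrite (le_trans (ler_normD _ _))// lerD ?fA ?gB.
exists (M `|` N); first by rewrite finite_setU.
move=> t t01 /not_orP[Mt Nt].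
by apply: cvgD; [exact: fc|exact: gc].
Qed.

Lemma bounded_cofinitely_continuousM f g :
  bounded_cofinitely_continuous f -> bounded_cofinitely_continuous g ->
  bounded_cofinitely_continuous (fun t => f t * g t).
Proof.
move=> [[A fA] [M finM fc]] [[B gB] [N finN gc]]; split.
  by exists (A * B) => t t01; rewrite normrM ler_pM// ?fA ?gB.
exists (M `|` N); first by rewrite finite_setU.
move=> t t01 /not_orP[Mt Nt].
by apply: cvgM; [exact: fc|exact: gc].
Qed.

Lemma bounded_cofinitely_continuousX f (n : nat) :
  bounded_cofinitely_continuous f ->
  bounded_cofinitely_continuous (fun t => f t ^+ n).
Proof.
move=> fbc; elim: n => [|n IHn]; first exact: bounded_cofinitely_continuous_cst.
under eq_fun do rewrite exprS.
exact: bounded_cofinitely_continuousM.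
Qed.

Lemma bounded_cofinitely_continuous_sum (I : Type) (r : seq I)
    (F : I -> R -> R) :
  (forall i, bounded_cofinitely_continuous (F i)) ->
  bounded_cofinitely_continuous (fun t => \sum_(i <- r) F i t).
Proof.
move=> Fbc; elim: r => [|i r IHr].
  under eq_fun do rewrite big_nil; exact: bounded_cofinitely_continuous_cst.
under eq_fun do rewrite big_cons.
exact: bounded_cofinitely_continuousD.
Qed.

(** Induction on the breakpoints: a point before the first one, [c], lies in the first piece, and a
    point after it is handled by the tail, which partitions the interval from [c] to [b]. *)
Lemma itv_partition_mem (a b t : R) (s : seq R) :
    itv_partition a b s -> t \in `]a, b[ -> t \notin s ->
  exists2 i, (i < size s)%N & t \in `](nth b (a :: s) i), (nth b s i)[.
Proof.
elim: s a => [|c s IHs] a [].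
  (* Without breakpoints [a = b], and the open interval is empty. *)
  by move=> _ /eqP/= <-; rewrite in_itv/= => /andP[at_ ta];
    move: (lt_trans at_ ta); rewrite ltxx.
move=> /= /andP[ac cs] sb; rewrite in_itv/= => /andP[at_ tb].
rewrite in_cons negb_or => /andP[tc ts].
have [tltc|ctlt|tE] := ltgtP t c; last by rewrite tE eqxx in tc.
  by exists 0%N => //=; rewrite in_itv/= at_.
have tcb : t \in `]c, b[ by rewrite in_itv/= ctlt.
have [i si ti] := IHs c (conj cs sb) tcb ts.
by exists i.+1.
Qed.

Lemma bounded_piecewise_continuousW f :
  bounded_piecewise_continuous 0 1 f -> bounded_cofinitely_continuous f.
Proof.
(* Boundedness is phrased through the filter [globally]; a bound is extracted once this filter is
   proper, that is, once the interval is nonempty. *)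
have ne01 : (`[0, 1]%classic : set R) 0 by rewrite /= bound_itvE.
have PF01 := globally_properfilter ne01.
move=> [/(@ex_bound _ _ _ _ _ PF01)[M fM] [s sP fc]]; split.
  by exists M => t /fM.
exists [set` s]; first exact: finite_seq.
move=> t t01 /negP st; have [i si ti] := itv_partition_mem sP t01 st.
exact: fc ti.
Qed.

End BoundedCofinitelyContinuous.

(** * Application to sampled curves *)

(** Barycentric coordinates are fixed linear combinations of 1 and the affine components, and
    homogeneous coordinates are the components themselves. *)
Lemma bounded_cofinitely_continuous_curve_uvw (R : realType)
    (p : planar_curve R) (i : 'I_3) : regular_components p ->
  bounded_cofinitely_continuous (fun t => curve_uvw p t 0 i).
Proof.
case: p => [T f|h] /= reg; last exact: bounded_piecewise_continuousW.
rewrite /barycentric; under eq_fun do rewrite mxE.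
apply: bounded_cofinitely_continuous_sum => j.
apply: bounded_cofinitely_continuousM; last first.
  exact: bounded_cofinitely_continuous_cst.
rewrite /homogenize; under eq_fun do rewrite mxE.
(* The first column of the homogenized point is the constant 1; the other two are the affine
   components. *)
case: (@fintype.split 1 2 j) => j'; last exact: bounded_piecewise_continuousW.
by under eq_fun do rewrite mxE; exact: bounded_cofinitely_continuous_cst.
Qed.

Lemma bounded_cofinitely_continuous_bernstein (R : realType) (m : nat)
    (p : planar_curve R) (k : 'I_('C(m + 2, 2))) : regular_components p ->
  bounded_cofinitely_continuous (fun t => bernstein k (curve_uvw p t)).
Proof.
move=> reg; rewrite /bernstein; case: (nth _ _ _) => [[k1 k2] k3].
apply: bounded_cofinitely_continuousM.
  exact: bounded_cofinitely_continuous_cst.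
by do 2?[apply: bounded_cofinitely_continuousM];
  apply: bounded_cofinitely_continuousX;
  exact: bounded_cofinitely_continuous_curve_uvw.
Qed.

Theorem proposition2 (R : realType) (m : nat) (p : planar_curve R)
    (p_wf : wf_curve p) (p_reg : regular_components p)
    (k l : 'I_('C(m + 2, 2))) :
  (fun L : nat =>
     L%:R^-1 * ((sample_matrix m p L)^T *m sample_matrix m p L) k l)
    @ \oo --> gram_matrix m p k l.
Proof.
have klbc := bounded_cofinitely_continuousM
  (bounded_cofinitely_continuous_bernstein k p_reg)
  (bounded_cofinitely_continuous_bernstein l p_reg).
rewrite mxE; have := riemann_sum_cvg klbc.
apply: cvg_trans; apply: near_eq_cvg; apply: nearW => L.
(* The matrix product sums over the rows, that is, over the nodes, the product of the two Bernstein
   values. *)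
by rewrite mxE; congr (_ * _); apply: eq_bigr => j _; rewrite !mxE.
Qed.
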